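(* Let $(Y^0_0,Y^1_0,Y^0_1,Y^1_1,D,X)$ be the potential outcome curves (on a compact interval $\mathcal T\subset\mathbb R$), group indicator $D\in\{0,1\}$ and covariates $X\in\mathbb R^p$ of a unit. Assume: (i) (no anticipation) $Y^1_0(\cdot)=Y^0_0(\cdot)$ almost surely; (ii) (consistency) the observed curves are $Y_0=Y^0_0$ and $Y_1=D\,Y^1_1+(1-D)Y^0_1$; (iii) (conditional functional parallel trends) for every $t\in\mathcal T$, $\mathbb E\{\Delta Y^0(t)\mid X,D=1\}=\mathbb E\{\Delta Y^0(t)\mid X,D=0\}$; (iv) (overlap) there is $\underline c\in(0,1/2)$ with $\underline c\le \pi_0(X)\le 1-\underline c$ almost surely. Then the functional average treatment effect on the treated $\tau_0(t)=\mathbb E\{Y^1_1(t)-Y^0_1(t)\mid D=1\}$ is identified from the law of $(\Delta Y,D,X)$ by both of the following formulas, for every $t\in\mathcal T$: $$\tau_0(t)=\mathbb E\{\mu_1(X)(t)-\mu_0(X)(t)\mid D=1\},$$ $$\tau_0(t)=\mathbb E\Big\{\frac{D}{p_0}\Delta Y(t)\Big\}-\mathbb E\Big\{\frac{(1-D)\pi_0(X)}{p_0\{1-\pi_0(X)\}}\Delta Y(t)\Big\}.$$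
   Context: Two periods $T\in\{0,1\}$ (pre, post). $Y^d_T(\cdot)$ is the potential outcome curve at period $T$ under treatment status $d\in\{0,1\}$; $\mathcal T\subset\mathbb R$ is a compact interval, curves are random elements of $L^2(\mathcal T)$ (with jointly measurable versions, so that evaluation at $t$ makes sense), and the displayed expectations and conditional expectations are assumed to exist. $D=1$ denotes the treated group, treated only in the post period. $\Delta Y=Y_1-Y_0$ is the observed change and $\Delta Y^d=Y^d_1-Y^d_0$ the potential change. $\pi_0(x)=\mathbb P(D=1\mid X=x)$, $p_0=\mathbb P(D=1)$, and $\mu_a(x)(t)=\mathbb E\{\Delta Y(t)\mid X=x,D=a\}$ for $a\in\{0,1\}$. *)

(* Defs.v *)
From HB Require Import structures.
From mathcomp Require Import all_boot all_order all_algebra.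
From mathcomp Require Import all_classical all_reals all_analysis.

Set Implicit Arguments.
Unset Strict Implicit.
Unset Printing Implicit Defensive.

Import Order.TTheory GRing.Theory Num.Theory.
Import numFieldNormedType.Exports.

Local Open Scope classical_set_scope.
Local Open Scope ring_scope.
Local Open Scope ereal_scope.

(* R^p is p.-tuple R, with the sigma-algebra generated by the coordinates,
   i.e. the Borel sigma-algebra. *)

(* m is a version of w |-> E(Z | W = w): the random variable m(W) is a version
   of the conditional expectation of Z given the sigma-algebra of W. *)
Definition is_condexp (R : realType) (d d' : measure_display)
    (Omega : measurableType d) (E : measurableType d') (P : probability Omega R)
    (Z : Omega -> R) (W : Omega -> E) (m : E -> R) : Prop :=
  [/\ P.-integrable setT (EFin \o Z),
      measurable_fun setT m,
      P.-integrable setT (EFin \o (m \o W)) &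
      forall C : set E, measurable C ->
        \int[P]_(w in W @^-1` C) (Z w)%:E
        = \int[P]_(w in W @^-1` C) (m (W w))%:E].

(* E(Z | A) for an event A of positive probability *)
Definition expect_given (R : realType) (d : measure_display)
    (Omega : measurableType d) (P : probability Omega R)
    (A : set Omega) (Z : Omega -> R) : \bar R :=
  ((fine (P A))^-1)%:E * \int[P]_(w in A) (Z w)%:E.

(* A jointly measurable version of a random element of L^2([a, b]); the values
   outside [a, b] are irrelevant. *)
Definition random_curve (R : realType) (d : measure_display)
    (Omega : measurableType d) (P : probability Omega R) (a b : R)
    (Z : Omega -> R -> R) : Prop :=
  measurable_fun ([set: Omega] `*` `[a, b]%classic)
    (fun wt : Omega * R => Z wt.1 wt.2) /\
  {ae P, forall w, \int[lebesgue_measure]_(t in `[a, b]) (Z w t ^+ 2)%:E < +oo}.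

(* Change from the pre period (false) to the post period (true) *)
Definition change (R : realType) (Omega : Type) (Z : bool -> Omega -> R -> R)
    (t : R) (w : Omega) : R := (Z true w t - Z false w t)%R.

(* Y i s w t is the potential outcome curve of unit w under treatment status i
   at period s (false = pre, true = post), evaluated at t; Yobs s w t is the
   observed curve at period s. *)
Record did_model (R : realType) (a b : R) (p : nat) (d : measure_display)
    (Omega : measurableType d) (P : probability Omega R)
    (Y : bool -> bool -> Omega -> R -> R) (Yobs : bool -> Omega -> R -> R)
    (D : Omega -> bool) (X : Omega -> p.-tuple R) : Prop := DidModel {
  did_curves : forall i s, random_curve P a b (Y i s);
  did_group : measurable_fun setT D;
  did_covariates : measurable_fun setT X;
  did_no_anticipation :
    {ae P, forall w, forall t, t \in `[a, b] ->
       Y true false w t = Y false false w t};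
  did_consistency_pre : forall w t, t \in `[a, b] ->
    Yobs false w t = Y false false w t;
  did_consistency_post : forall w t, t \in `[a, b] ->
    Yobs true w t
    = ((D w)%:R * Y true true w t + (1 - (D w)%:R) * Y false true w t)%R;
  (* existence of the expectations of the observed change *)
  did_integrable : forall t, t \in `[a, b] ->
    P.-integrable setT (EFin \o change Yobs t);
  (* E{. | X, D = i} is m(X, i), with m a version of E{. | (X, D) = .}; under
     overlap the equality does not depend on the version. *)
  did_parallel_trends : forall t, t \in `[a, b] ->
    exists2 m : p.-tuple R * bool -> R,
      is_condexp P (change (Y false) t) (fun w => (X w, D w)) m &
      {ae P, forall w, m (X w, true) = m (X w, false)};
  did_overlap : exists2 c : R, (0 < c < 2^-1)%R &
    exists2 pi0 : p.-tuple R -> R,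
      is_condexp P (fun w => (D w)%:R) X pi0 &
      {ae P, forall w, (c <= pi0 (X w) <= 1 - c)%R}
}.

Definition fatt (R : realType) (d : measure_display)
    (Omega : measurableType d) (P : probability Omega R)
    (Y : bool -> bool -> Omega -> R -> R) (D : Omega -> bool) (t : R) : \bar R :=
  expect_given P [set w | D w] (fun w => (Y true true w t - Y false true w t)%R).

(* Two triples (dY(t), D, X) and (dY'(t), D', X'), possibly on different
   probability spaces, have the same joint law. *)
Definition same_law (R : realType) (p : nat) (d d' : measure_display)
    (Omega : measurableType d) (Omega' : measurableType d')
    (P : probability Omega R) (P' : probability Omega' R)
    (Z : Omega -> R) (D : Omega -> bool) (X : Omega -> p.-tuple R)
    (Z' : Omega' -> R) (D' : Omega' -> bool) (X' : Omega' -> p.-tuple R) : Prop :=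
  forall A : set (R * bool * p.-tuple R), measurable A ->
    pushforward P (fun w => (Z w, D w, X w)) A
    = pushforward P' (fun w => (Z' w, D' w, X' w)) A.

(* Main.v *)
Require Import Defs.
From HB Require Import structures.
From mathcomp Require Import all_boot all_order all_algebra.
From mathcomp Require Import all_classical all_reals all_analysis.
From mathcomp Require Import measurable_realfun ring lra.

Set Implicit Arguments.
Unset Strict Implicit.
Unset Printing Implicit Defensive.

Import Order.TTheory GRing.Theory Num.Theory.
Import numFieldNormedType.Exports HBNNSimple.

Local Open Scope classical_set_scope.
Local Open Scope ring_scope.
Local Open Scope ereal_scope.

(** Consistency and parallel trends reduce both formulas to the mean over the
    treated of the untreated change Z0, whose conditional expectation
    m(X, 1) = m(X, 0) is shared by the two groups.  For the regression formula,
    the observed change equals Z0 on the untreated, so mu_0(X) = m(X, 0) there,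
    and overlap extends this almost sure equality to everyone.  For the
    weighting formula, with w = pi0 / (1 - pi0) one has
    E{(D - (1 - D) w(X)) Z0} = E{(D - (1 - D) w(X)) m(X, 0)}
    = E{(D - pi0(X)) m(X, 0) / (1 - pi0(X))} = 0.
    The weighting formula only involves the law of the observables, because a
    version of pi0 for one model is also a version for any model with the same
    law. *)

(** * Measurable inverses, integrals over events and the pull-out property *)

(** Writing the inverse as [f] times the power -1 of [f ^+ 2] reduces the claim to real powers. The
    identity also holds where [f] vanishes, since the inverse of 0 is 0. *)
Lemma measurable_funV (R : realType) (d : measure_display)
    (T : measurableType d) (f : T -> R) :
  measurable_fun setT f -> measurable_fun setT (fun x => (f x)^-1)%R.
Proof.
move=> mf.
have -> : (fun x => (f x)^-1)%R = (fun x => powR (f x ^+ 2) (-1) * f x)%R.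
  apply/funext => x; rewrite powR_inv1 ?sqr_ge0//.
  have [->|f0] := eqVneq (f x) 0%R; first by rewrite invr0 mulr0.
  by field.
apply: measurable_funM => //.
exact: (measurableT_comp (measurable_powR (-1)%R) (measurable_funX 2 mf)).
Qed.

Lemma integral_bool (R : realType) (d : measure_display)
    (T : measurableType d) (P : probability T R) (D : T -> bool) (f : T -> R) :
  \int[P]_(w in [set w | D w]) (f w)%:E
  = \int[P]_w ((D w)%:R * f w)%:E.
Proof.
rewrite integral_mkcond; apply: eq_integral => w _.
rewrite patchE; case: ifPn; rewrite ?inE /=.
  by move=> ->; rewrite mul1r.
by rewrite notin_setE /=; case: (D w) => // _; rewrite mul0r.
Qed.

(* The pull-out property of conditional expectation, for E(U | W) = 0. *)
Lemma integral_weight_eq0 (R : realType) (d d' : measure_display)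
    (Omega : measurableType d) (E : measurableType d') (P : probability Omega R)
    (U : Omega -> R) (W : Omega -> E) (f : E -> R) :
  measurable_fun setT W -> P.-integrable setT (EFin \o U) ->
  (forall C, measurable C -> \int[P]_(w in W @^-1` C) (U w)%:E = 0) ->
  measurable_fun setT f ->
  P.-integrable setT (fun w => (f (W w) * U w)%:E) ->
  \int[P]_w (f (W w) * U w)%:E = 0.
Proof.
move=> mW iU U0.
have mU : measurable_fun setT U.
  by apply/measurable_EFinP; exact: measurable_int iU.
(* The positive and negative parts of [f] are dominated by its absolute value, so each inherits
   integrability against [U], and the signed case follows by subtraction. *)
wlog f0 : f / forall x, (0 <= f x)%R.
  move=> ge0_case mf ifU.
  have part (g : E -> R) : measurable_fun setT g ->
      (forall x, 0 <= g x)%R -> (forall x, `|g x| <= `|f x|)%R ->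
      P.-integrable setT (fun w => (g (W w) * U w)%:E) /\
      \int[P]_w (g (W w) * U w)%:E = 0.
    move=> mg g0 gf.
    have ig : P.-integrable setT (fun w => (g (W w) * U w)%:E).
      apply: (le_integrable measurableT _ _ ifU).
        apply/measurable_EFinP/measurable_funM => //.
        exact: measurableT_comp.
      by move=> w _; rewrite /= lee_fin !normrM ler_wpM2r.
    by split => //; exact: ge0_case.
  have fE := funrposBneg f.
  have [| | |ip p0] := part f^\+%R.
  - exact: measurable_funrpos.
  - exact: funrpos_ge0.
  - move=> x; rewrite ger0_norm ?funrpos_ge0// /funrpos.
    by rewrite ge_max ler_norm normr_ge0.
  have [| | |in_ n0] := part f^\-%R.
  - exact: measurable_funrneg.
  - exact: funrneg_ge0.
  - move=> x; rewrite ger0_norm ?funrneg_ge0// /funrneg.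
    by rewrite ge_max normr_ge0 -normrN ler_norm.
  rewrite -[RHS](subee (x := 0)) // -{1}p0 -{1}n0 -integralB//.
  apply: eq_integral => w _; rewrite -EFinB; congr EFin.
  by rewrite -mulrBl -[in LHS]fE.
move=> mf ifU.
have mfE : measurable_fun setT (EFin \o f) by exact/measurable_EFinP.
pose s := nnsfun_approx measurableT mfE.
have s_cvg x : (s n x)%:E @[n --> \oo] --> (f x)%:E.
  by apply: (cvg_nnsfun_approx measurableT mfE) => // y _; rewrite lee_fin.
have s_le n x : (s n x <= f x)%R.
  have sx : s n x @[n --> \oo] --> f x.
    by have /fine_cvgP[_] := s_cvg x.
  rewrite -(cvg_lim _ sx)//.
  apply: (nondecreasing_cvgn_le (u_ := fun n => s n x)).
    move=> i j ij; have /lefP := nd_nnsfun_approx measurableT mfE ij.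
    exact.
  by apply/cvg_ex; exists (f x).
(* A simple function is a finite combination of indicators of its level sets, and the hypothesis on
   [U] applies to the preimage of each level set. *)
have s_int n : \int[P]_w (s n (W w) * U w)%:E = 0.
  transitivity (\int[P]_w (\sum_(y <- finmap.enum_fset (fset_set (range (s n))))
      (y%:E * ((\1_(s n @^-1` [set y]) (W w) * U w)%R)%:E))).
    apply: eq_integral => w _.
    rewrite fimfunE fsbig_finite//= mulr_suml -sumEFin.
    by apply: eq_bigr => y _; rewrite -EFinM mulrA.
  have iy y : P.-integrable setT
      (fun w => ((\1_(s n @^-1` [set y]) (W w) * U w)%R)%:E).
    apply: (le_integrable measurableT _ _ iU).
      apply/measurable_EFinP/measurable_funM => //.
      have m1 : measurable_fun setT (\1_(s n @^-1` [set y]) : E -> R).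
        exact: measurable_indic.
      exact: (measurableT_comp m1 mW).
    move=> w _; rewrite /= lee_fin normrM ler_piMl//.
    by rewrite indicE; case: (_ \in _); rewrite ?normr1 ?normr0.
  rewrite integral_sum//; last by move=> y; exact: integrableZl.
  rewrite big1// => y _; rewrite integralZl//.
  rewrite [X in _ * X](_ : _ = 0) ?mule0//.
  rewrite -(U0 (s n @^-1` [set y]))//.
  rewrite [RHS]integral_mkcond; apply: eq_integral => w _.
  rewrite patchE indicE; have -> : (w \in W @^-1` (s n @^-1` [set y]))
    = (W w \in s n @^-1` [set y]) by [].
  by case: ifP; rewrite ?mul1r ?mul0r.
(* As [0 <= s n <= f], the variable [|f(W) U|] dominates the whole sequence. *)
have [|||||_ _] := @dominated_convergence _ _ _ P setT measurableT
   (fun n w => (s n (W w) * U w)%:E) (fun w => (f (W w) * U w)%:E)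
   (fun w => `|(f (W w) * U w)%:E|).
- move=> n; apply/measurable_EFinP/measurable_funM => //.
  exact: measurableT_comp.
- by exact: measurable_int ifU.
- apply: aeW => w _ /=; under eq_fun do rewrite EFinM.
  by rewrite EFinM; apply: cvgeZr.
- exact: integrable_abse.
- apply: aeW => w n _ /=; rewrite lee_fin !normrM ler_wpM2r//.
  by rewrite ger0_norm// ger0_norm.
under eq_fun do rewrite s_int.
move=> /cvg_lim <- //.
by rewrite lim_cst.
Qed.

(** * Versions of conditional expectations: residuals, uniqueness, modification *)

Lemma ae_eq_integrable (R : realType) (d : measure_display)
    (Omega : measurableType d) (P : probability Omega R)
    (f g : Omega -> \bar R) :
  measurable_fun setT g -> ae_eq P setT f g ->
  P.-integrable setT f -> P.-integrable setT g.
Proof.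
move=> mg fg /integrableP[mf foo]; apply/integrableP; split => //.
rewrite (_ : \int[P]_x `|g x| = \int[P]_x `|f x|)//.
apply: ae_eq_integral => //; try exact: measurableT_comp.
by apply: filterS fg => x /(_ I) ->.
Qed.

Lemma measurable_natr_bool (R : realType) (d : measure_display)
    (T : measurableType d) (D : T -> bool) :
  measurable_fun setT D -> measurable_fun setT (fun w => (D w)%:R : R)%R.
Proof.
move=> mD.
have -> : (fun w => (D w)%:R : R)%R = (fun w => if D w then 1 else 0)%R.
  by apply/funext => w; case: (D w).
exact: measurable_fun_ifT.
Qed.

(** Recasts the defining property of a version as a statement on the residual, in the form that
    [integral_weight_eq0] takes as hypothesis. *)
Lemma condexp_centered (R : realType) (d d' : measure_display)
    (Omega : measurableType d) (E : measurableType d') (P : probability Omega R)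
    (Z : Omega -> R) (W : Omega -> E) (m : E -> R) :
  measurable_fun setT W -> is_condexp P Z W m ->
  P.-integrable setT (EFin \o (fun w => Z w - m (W w))%R) /\
  forall C, measurable C -> \int[P]_(w in W @^-1` C) (Z w - m (W w))%:E = 0.
Proof.
move=> mW [iZ mm im eqZm]; split.
  by have := integrableB measurableT iZ im; apply: eq_integrable.
move=> C mC.
have mWC : measurable (W @^-1` C) by rewrite -[X in measurable X]setTI; exact: mW.
have iZC := integrableS measurableT mWC (@subsetT _ _) iZ.
have imC := integrableS measurableT mWC (@subsetT _ _) im.
have fin : \int[P]_(w in W @^-1` C) (m (W w))%:E \is a fin_num.
  exact: (integrable_fin_num mWC imC).
rewrite -[RHS](subee fin) -{1}(eqZm C mC).
apply: etrans (integralB mWC iZC imC).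
by apply: eq_integral => w _; rewrite /= EFinB.
Qed.

Lemma ge0_integral_eq0_ae (R : realType) (d : measure_display)
    (Omega : measurableType d) (P : probability Omega R) (f : Omega -> R) :
  measurable_fun setT f -> {ae P, forall w, (0 <= f w)%R} ->
  \int[P]_w (f w)%:E = 0 -> {ae P, forall w, f w = 0%R}.
Proof.
move=> mf f0 if0.
have mfE : measurable_fun setT (EFin \o f) by exact/measurable_EFinP.
have /(ae_eq_integral_abs P measurableT mfE) : \int[P]_w `|(f w)%:E| = 0.
  rewrite -if0; apply: ae_eq_integral => //.
    exact: measurableT_comp.
  by apply: filterS f0 => w fw0 _; rewrite gee0_abs// lee_fin.
by apply: filterS => w /(_ I) [].
Qed.

(* Locality and almost sure uniqueness of conditional expectations in one
   statement: [b] is the event, measurable with respect to [W], on which the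
   two variables agree. *)
Lemma condexp_ae_eq_on (R : realType) (d d' : measure_display)
    (Omega : measurableType d) (E : measurableType d') (P : probability Omega R)
    (Z Z' : Omega -> R) (W : Omega -> E) (m m' : E -> R) (b : E -> bool) :
  measurable_fun setT W -> measurable_fun setT b ->
  is_condexp P Z W m -> is_condexp P Z' W m' ->
  (forall w, b (W w) -> Z w = Z' w) ->
  {ae P, forall w, b (W w) -> m (W w) = m' (W w)}.
Proof.
move=> mW mb Zm Zm' ZZ'.
have [iU U0] := condexp_centered mW Zm.
have [iU' U0'] := condexp_centered mW Zm'.
have [_ mm _ _] := Zm; have [_ mm' _ _] := Zm'.
(* On the event [b] the two variables cancel and the difference of residuals is [m - m']. The weight
   [f] is the sign of [m - m'] cut off outside [b], so the product is the absolute difference on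
   [b], with mean zero by the pull-out property. *)
pose U w := ((Z' w - m' (W w)) - (Z w - m (W w)))%R.
pose f x := ((b x)%:R * (if m x < m' x then -1 else 1))%R : R.
have mf : measurable_fun setT f.
  apply: measurable_funM; first exact: measurable_natr_bool.
  by apply: measurable_fun_ifT => //; exact: measurable_fun_ltr.
have fU w : (f (W w) * U w)%R = ((b (W w))%:R * `|m (W w) - m' (W w)|)%R.
  rewrite /f /U; case: (boolP (b (W w))) => [/ZZ' ->|_]; last by rewrite !mul0r.
  case: ltP => mm'W; first by rewrite ltr0_norm ?subr_lt0//; ring.
  by rewrite ger0_norm ?subr_ge0//; ring.
have iUU : P.-integrable setT (EFin \o U).
  by have := integrableB measurableT iU' iU; apply: eq_integrable.
have ifU : P.-integrable setT (fun w => (f (W w) * U w)%:E).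
  apply: (le_integrable measurableT _ _ iUU).
    apply/measurable_EFinP/measurable_funM; first exact: measurableT_comp.
    by apply/measurable_EFinP; exact: measurable_int iUU.
  move=> w _; rewrite /= lee_fin normrM ler_piMl// /f normrM.
  by case: (b _); case: ifP; rewrite ?normrN ?normr1 ?normr0 ?mul1r ?mul0r.
have int0 : \int[P]_w (f (W w) * U w)%:E = 0.
  apply: integral_weight_eq0 => // C mC.
  have mWC : measurable (W @^-1` C) by rewrite -[X in measurable X]setTI; exact: mW.
  have iC := integrableS measurableT mWC (@subsetT _ _) iU.
  have iC' := integrableS measurableT mWC (@subsetT _ _) iU'.
  rewrite -[RHS](subee (x := 0))// -{1}(U0' C mC) -(U0 C mC).
  by apply: etrans (integralB mWC iC' iC); apply: eq_integral.
have : {ae P, forall w, (f (W w) * U w = 0)%R}.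
  apply: ge0_integral_eq0_ae => //.
    by apply/measurable_EFinP; exact: measurable_int ifU.
  by apply: aeW => w; rewrite fU mulr_ge0.
apply: filterS => w; rewrite fU => + bW; rewrite bW mul1r.
by move=> /eqP; rewrite normr_eq0 subr_eq0 => /eqP.
Qed.

Lemma is_condexp_ae (R : realType) (d d' : measure_display)
    (Omega : measurableType d) (E : measurableType d') (P : probability Omega R)
    (Z : Omega -> R) (W : Omega -> E) (m m' : E -> R) :
  measurable_fun setT W -> measurable_fun setT m' ->
  {ae P, forall w, m (W w) = m' (W w)} ->
  is_condexp P Z W m -> is_condexp P Z W m'.
Proof.
move=> mW mm' mm'W [iZ mm im eqZm].
have mW' : measurable_fun setT (EFin \o (m' \o W)).
  by apply/measurable_EFinP; exact: measurableT_comp.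
have aem : ae_eq P setT (EFin \o (m \o W)) (EFin \o (m' \o W)).
  by apply: filterS mm'W => w /= -> _.
split => //.
  exact: ae_eq_integrable aem im.
move=> C mC; rewrite eqZm//.
have mWC : measurable (W @^-1` C) by rewrite -[X in measurable X]setTI; exact: mW.
apply: ae_eq_integral => //.
- apply: measurable_funTS; exact: measurable_int im.
- exact: measurable_funTS mW'.
- by apply: filterS mm'W => w -> _.
Qed.

(** * Bounded weights, overlap and inverse propensity weighting *)

Lemma integrable_weight (R : realType) (d : measure_display)
    (Omega : measurableType d) (P : probability Omega R) (k : R)
    (f h : Omega -> R) :
  measurable_fun setT f -> (forall w, `|f w| <= k)%R ->
  P.-integrable setT (EFin \o h) ->
  P.-integrable setT (fun w => (f w * h w)%:E).
Proof.
move=> mf fk ih.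
apply: (le_integrable measurableT _ _ (integrableZl measurableT k ih)).
  apply/measurable_EFinP/measurable_funM => //.
  by apply/measurable_EFinP; exact: measurable_int ih.
move=> w _; rewrite /= lee_fin !normrM ler_wpM2r//.
exact: le_trans (fk w) (ler_norm k).
Qed.

Lemma integrable_boolM (R : realType) (d : measure_display)
    (Omega : measurableType d) (P : probability Omega R)
    (D : Omega -> bool) (h : Omega -> R) :
  measurable_fun setT D -> P.-integrable setT (EFin \o h) ->
  P.-integrable setT (fun w => ((D w)%:R * h w)%:E).
Proof.
move=> mD; apply: (@integrable_weight _ _ _ _ 1).
  exact: measurable_natr_bool.
by move=> w; case: (D w); rewrite ?normr1 ?normr0.
Qed.

(** The treated event belongs to the sigma-algebra of [(X, D)], so this is the defining property on
    that event. *)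
Lemma condexp_integral_bool (R : realType) (d d' : measure_display)
    (Omega : measurableType d) (E : measurableType d') (P : probability Omega R)
    (Z : Omega -> R) (D : Omega -> bool) (X : Omega -> E) (m : E * bool -> R) :
  measurable_fun setT D ->
  is_condexp P Z (fun w => (X w, D w)) m ->
  \int[P]_w ((D w)%:R * Z w)%:E = \int[P]_w ((D w)%:R * m (X w, D w))%:E.
Proof.
move=> mD [_ _ _ eqZm].
have mC : measurable ((@snd E bool) @^-1` [set true]).
  by rewrite -[X in measurable X]setTI; exact: measurable_snd.
by have := eqZm _ mC; rewrite !(integral_bool P D).
Qed.

(** Let [f] be the indicator of [g != 0]. Almost surely [f(X)] vanishes on the untreated, so
    [f(X) (1 - pi0(X))] equals [f(X) (D - pi0(X))], which has mean zero. Since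
    [1 - pi0(X) >= c > 0], this forces [f(X) = 0] almost surely. *)
Lemma overlap_ae_eq0 (R : realType) (d d' : measure_display)
    (Omega : measurableType d) (E : measurableType d') (P : probability Omega R)
    (D : Omega -> bool) (X : Omega -> E) (pi0 g : E -> R) (c : R) :
  measurable_fun setT D -> measurable_fun setT X -> measurable_fun setT g ->
  is_condexp P (fun w => (D w)%:R) X pi0 -> (0 < c)%R ->
  {ae P, forall w, (pi0 (X w) <= 1 - c)%R} ->
  {ae P, forall w, ~~ D w -> g (X w) = 0%R} ->
  {ae P, forall w, g (X w) = 0%R}.
Proof.
move=> mD mX mg pi0D c0 pi0c g0.
have [iU U0] := condexp_centered mX pi0D; have [_ mpi0 _ _] := pi0D.
pose f x := (g x != 0)%R%:R%R : R.
have mf : measurable_fun setT f.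
  apply: measurable_natr_bool; apply: measurable_neg.
  exact: measurable_fun_eqr.
have mfX : measurable_fun setT (fun w => f (X w)) by exact: measurableT_comp.
have ifU : P.-integrable setT (fun w => (f (X w) * ((D w)%:R - pi0 (X w)))%:E).
  apply: (integrable_weight (k := 1)) => // w.
  by rewrite /f; case: (g _ != _); rewrite ?normr1 ?normr0.
have int0 := integral_weight_eq0 mX iU U0 mf ifU.
have mh : measurable_fun setT (fun w => f (X w) * (1 - pi0 (X w)))%R.
  apply: measurable_funM => //; apply: measurable_funB => //.
  exact: measurableT_comp.
have f0 : {ae P, forall w, (f (X w) * (1 - pi0 (X w)) = 0)%R}.
  apply: ge0_integral_eq0_ae => //.
    by apply: filterS pi0c => w pw; rewrite mulr_ge0//; lra.
  rewrite -[RHS]int0; apply: ae_eq_integral => //.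
  - exact/measurable_EFinP.
  - exact: measurable_int ifU.
  - apply: filterS g0 => w gw _; congr EFin; rewrite /f.
    by case: (boolP (D w)) gw => [//|_ ->//]; rewrite eqxx !mul0r.
apply: filterS2 f0 pi0c => w; rewrite /f.
by have [//|_] := eqVneq (g (X w)) 0%R; rewrite mul1r; lra.
Qed.

(** Reweighting the untreated by the odds of treatment reproduces the mean over the treated. The
    bounds on [pi0] are imposed at every point so that the weights are bounded functions;
    [bounded_propensity] supplies such a version. *)
Lemma inverse_propensity_weighting (R : realType) (d d' : measure_display)
    (Omega : measurableType d) (E : measurableType d') (P : probability Omega R)
    (D : Omega -> bool) (X : Omega -> E) (Z : Omega -> R)
    (m : E * bool -> R) (pi0 : E -> R) (c : R) :
  measurable_fun setT D -> measurable_fun setT X ->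
  is_condexp P Z (fun w => (X w, D w)) m ->
  {ae P, forall w, m (X w, true) = m (X w, false)} ->
  is_condexp P (fun w => (D w)%:R) X pi0 ->
  (0 < c)%R -> (forall x, c <= pi0 x <= 1 - c)%R ->
  P.-integrable setT
    (fun w => ((1 - (D w)%:R) * (pi0 (X w) / (1 - pi0 (X w))) * Z w)%:E) /\
  \int[P]_w ((1 - (D w)%:R) * (pi0 (X w) / (1 - pi0 (X w))) * Z w)%:E
  = \int[P]_w ((D w)%:R * Z w)%:E.
Proof.
move=> mD mX Zm mTF pi0D c0 pi0c.
have [iZ mm im _] := Zm; have [_ mpi0 _ _] := pi0D.
have mXD := measurable_fun_pair mX mD.
have mV : measurable_fun setT (fun x => (1 - pi0 x)^-1)%R.
  by apply: measurable_funV; exact: measurable_funB.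
(* Since [1 - pi0 >= c] and [pi0 <= 1], both the inverse and the odds are at most [c^-1]; hence the
   bound [c^-1 + 1] for the weight [v] below. *)
have V_le x : (0 <= (1 - pi0 x)^-1 <= c^-1)%R.
  have /andP[? ?] := pi0c x.
  by rewrite invr_ge0 lef_pV2 ?posrE; [apply/andP; split|..]; lra.
have mw : measurable_fun setT (fun x => pi0 x / (1 - pi0 x))%R.
  exact: measurable_funM.
have w_le x : (0 <= pi0 x / (1 - pi0 x) <= c^-1)%R.
  have /andP[? ?] := pi0c x; have /andP[V0 Vc] := V_le x.
  rewrite mulr_ge0//=; last by lra.
  by apply: le_trans Vc; rewrite ler_piMl//; lra.
pose v (xi : E * bool) :=
  ((1 - xi.2%:R) * (pi0 xi.1 / (1 - pi0 xi.1)) - xi.2%:R)%R : R.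
have mi : measurable_fun setT (fun xi : E * bool => xi.2%:R : R)%R.
  by apply: measurable_natr_bool; exact: measurable_snd.
have mv : measurable_fun setT v.
  apply: measurable_funB => //; apply: measurable_funM; first exact: measurable_funB.
  exact: (measurableT_comp mw measurable_fst).
have vk xi : (`|v xi| <= c^-1 + 1)%R.
  have /andP[? ?] := w_le xi.1.
  rewrite /v; case: xi.2 => /=; rewrite ler_norml; apply/andP; split; lra.
have mvW : measurable_fun setT (fun w => v (X w, D w)).
  exact: (measurableT_comp mv mXD).
have [iU U0] := condexp_centered mXD Zm.
have ivU := integrable_weight mvW (fun w => vk (X w, D w)) iU.
have ivZ := integrable_weight mvW (fun w => vk (X w, D w)) iZ.
have ivm := integrable_weight mvW (fun w => vk (X w, D w)) im.
have vU0 := integral_weight_eq0 mXD iU U0 mv ivU.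
have iDZ := integrable_boolM mD iZ.
have iwZ : P.-integrable setT
    (fun w => ((1 - (D w)%:R) * (pi0 (X w) / (1 - pi0 (X w))) * Z w)%:E).
  have := integrableD measurableT ivZ iDZ; apply: eq_integrable => // w _ /=.
  by rewrite -EFinD /v /=; congr EFin; ring.
split => //.
(* With g(x) = m(x, 0), v(X, D) g(X) = (pi0(X) - D) g(X) / (1 - pi0(X)) has
   mean zero by a second application of [integral_weight_eq0], given X alone. *)
pose g x := m (x, false).
have mg : measurable_fun setT g.
  apply: (measurableT_comp mm); apply: measurable_fun_pair => //.
have gD : {ae P, forall w, m (X w, D w) = g (X w)}.
  by apply: filterS mTF => w; rewrite /g; case: (D w).
have mgX : measurable_fun setT (fun w => g (X w)) by exact: measurableT_comp.
have ig : P.-integrable setT (EFin \o (fun w => g (X w))).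
  apply: ae_eq_integrable im; first exact/measurable_EFinP.
  by apply: filterS gD => w /= -> _.
pose f x := (- (g x * (1 - pi0 x)^-1))%R.
have mf : measurable_fun setT f by apply: measurable_funN; exact: measurable_funM.
have [iV V0] := condexp_centered mX pi0D.
have fV w : (f (X w) * ((D w)%:R - pi0 (X w)) = v (X w, D w) * g (X w))%R.
  have /andP[? ?] := pi0c (X w).
  have ? : (1 - pi0 (X w) != 0)%R by apply/negP => /eqP; lra.
  by rewrite /f /v /=; case: (D w) => /=; field.
have ivg : P.-integrable setT (fun w => (v (X w, D w) * g (X w))%:E).
  exact: (integrable_weight mvW (fun w => vk (X w, D w)) ig).
have vg0 : \int[P]_w (v (X w, D w) * g (X w))%:E = 0.
  rewrite -[RHS](integral_weight_eq0 mX iV V0 mf).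
    by apply: eq_integral => w _; rewrite fV.
  by under eq_fun do rewrite fV.
have vm0 : \int[P]_w (v (X w, D w) * m (X w, D w))%:E = 0.
  rewrite -[RHS]vg0; apply: ae_eq_integral => //.
  - exact: measurable_int ivm.
  - exact: measurable_int ivg.
  - by apply: filterS gD => w /= -> _.
(* [Z] splits into its residual and [m(X, D)], both of mean zero against [v]. Adding [D Z] to [v Z]
   then leaves the odds-weighted integrand. *)
have vZ0 : \int[P]_w (v (X w, D w) * Z w)%:E = 0.
  rewrite -[RHS](adde0 0) -{1}vU0 -vm0 -integralD//.
  by apply: eq_integral => w _; rewrite -EFinD; congr EFin; ring.
rewrite -[RHS]add0e -vZ0 -integralD//.
by apply: eq_integral => w _; rewrite -EFinD; congr EFin; rewrite /v /=; ring.
Qed.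

(** * The effect on the treated in the difference-in-differences model *)

(** Any version of the propensity agrees almost surely with the one given by overlap, so truncating
    it to [[c, 1 - c]] leaves [pi0(X)] unchanged almost surely and makes the bounds hold
    everywhere. *)
Lemma bounded_propensity (R : realType) (a b : R) (p : nat)
    (d : measure_display) (Omega : measurableType d) (P : probability Omega R)
    (Y : bool -> bool -> Omega -> R -> R) (Yobs : bool -> Omega -> R -> R)
    (D : Omega -> bool) (X : Omega -> p.-tuple R) (pi0 : p.-tuple R -> R) :
  did_model a b P Y Yobs D X ->
  is_condexp P (fun w => (D w)%:R) X pi0 ->
  exists c : R, exists pi1 : p.-tuple R -> R,
    [/\ (0 < c)%R, (forall x, c <= pi1 x <= 1 - c)%R,
        is_condexp P (fun w => (D w)%:R) X pi1 &
        {ae P, forall w, pi0 (X w) = pi1 (X w)}].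
Proof.
move=> M pi0D; have mX := did_covariates M.
have [_ mpi0 _ _] := pi0D.
have [c /andP[c0 c2] [pi2 pi2D pi2c]] := did_overlap M.
(* With the sure event, [condexp_ae_eq_on] becomes plain uniqueness. *)
have mT : measurable_fun setT (fun _ : p.-tuple R => true) by exact: measurable_cst.
have pi02 := condexp_ae_eq_on mX mT pi0D pi2D (fun _ _ => erefl).
pose pi1 x := Num.max c (Num.min (pi0 x) (1 - c)%R).
have pi01 : {ae P, forall w, pi0 (X w) = pi1 (X w)}.
  apply: filterS2 pi02 pi2c => w /(_ isT) e /andP[cp pc].
  by rewrite /pi1 e (min_idPl pc) (max_idPr cp).
exists c, pi1; split => //.
  (* What remains is [c <= 1 - c], which follows from [c < 1/2]. *)
  move=> x; rewrite /pi1 le_max lexx /= ge_max ge_min lexx orbT andbT.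
  by lra.
apply: is_condexp_ae pi01 pi0D => //.
by apply: measurable_maxr => //; exact: measurable_minr.
Qed.

(** On the treated, the observed and untreated changes start from the same pre-period curve, which
    cancels and leaves the treatment effect. Only the second integral remains to be expressed
    through observables. *)
Lemma fatt_decomp (R : realType) (a b : R) (p : nat)
    (d : measure_display) (Omega : measurableType d) (P : probability Omega R)
    (Y : bool -> bool -> Omega -> R -> R) (Yobs : bool -> Omega -> R -> R)
    (D : Omega -> bool) (X : Omega -> p.-tuple R) (t : R) :
  did_model a b P Y Yobs D X -> t \in `[a, b] ->
  fatt P Y D t
  = ((fine (P [set w | D w]))^-1)%:E *
    (\int[P]_w ((D w)%:R * change Yobs t w)%:E
     - \int[P]_w ((D w)%:R * change (Y false) t w)%:E).
Proof.
move=> M tab; have mD := did_group M.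
have [m [iZ0 _ _ _] _] := did_parallel_trends M tab.
have iZ := did_integrable M tab.
have iDZ := integrable_boolM mD iZ; have iDZ0 := integrable_boolM mD iZ0.
rewrite /fatt /expect_given; congr (_ * _).
rewrite integral_bool; apply: etrans (integralB measurableT iDZ iDZ0).
apply: eq_integral => w _; rewrite -EFinB; congr EFin.
rewrite /change (did_consistency_pre M)// (did_consistency_post M)//.
by case: (D w) => /=; ring.
Qed.

Lemma change_untreated (R : realType) (a b : R) (p : nat)
    (d : measure_display) (Omega : measurableType d) (P : probability Omega R)
    (Y : bool -> bool -> Omega -> R -> R) (Yobs : bool -> Omega -> R -> R)
    (D : Omega -> bool) (X : Omega -> p.-tuple R) (t : R) (w : Omega) :
  did_model a b P Y Yobs D X -> t \in `[a, b] -> ~~ D w ->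
  change Yobs t w = change (Y false) t w.
Proof.
move=> M tab Dw; rewrite /change (did_consistency_pre M)//.
by rewrite (did_consistency_post M)// (negPf Dw) mul0r add0r subr0 mul1r.
Qed.

(** The factor [1 - D] kills the treated, and on the untreated the observed change is the untreated
    one, so inverse propensity weighting applies to observables. Integrability is recorded for later
    scaling and transfer. *)
Lemma fatt_weighting (R : realType) (a b : R) (p : nat)
    (d : measure_display) (Omega : measurableType d) (P : probability Omega R)
    (Y : bool -> bool -> Omega -> R -> R) (Yobs : bool -> Omega -> R -> R)
    (D : Omega -> bool) (X : Omega -> p.-tuple R)
    (pi0 : p.-tuple R -> R) (c t : R) :
  did_model a b P Y Yobs D X -> t \in `[a, b] ->
  is_condexp P (fun w => (D w)%:R) X pi0 ->
  (0 < c)%R -> (forall x, c <= pi0 x <= 1 - c)%R ->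
  P.-integrable setT (fun w => ((1 - (D w)%:R) *
      (pi0 (X w) / (1 - pi0 (X w))) * change Yobs t w)%:E) /\
  fatt P Y D t
  = ((fine (P [set w | D w]))^-1)%:E *
    (\int[P]_w ((D w)%:R * change Yobs t w)%:E
     - \int[P]_w ((1 - (D w)%:R) *
         (pi0 (X w) / (1 - pi0 (X w))) * change Yobs t w)%:E).
Proof.
move=> M tab pi0D c0 pi0c; have mD := did_group M; have mX := did_covariates M.
have [m Z0m mTF] := did_parallel_trends M tab.
have [iwZ eZ] := inverse_propensity_weighting mD mX Z0m mTF pi0D c0 pi0c.
have wZ w : ((1 - (D w)%:R) * (pi0 (X w) / (1 - pi0 (X w))) * change Yobs t w
    = (1 - (D w)%:R) * (pi0 (X w) / (1 - pi0 (X w))) * change (Y false) t w)%R.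
  case: (boolP (D w)) => [_|/(change_untreated M tab) ->//].
  by rewrite subrr !mul0r.
split; first by under eq_fun do rewrite wZ.
rewrite (fatt_decomp M tab) -eZ.
by congr (_ * (_ - _)); apply: eq_integral => w _; rewrite wZ.
Qed.

Lemma fatt_regression (R : realType) (a b : R) (p : nat)
    (d : measure_display) (Omega : measurableType d) (P : probability Omega R)
    (Y : bool -> bool -> Omega -> R -> R) (Yobs : bool -> Omega -> R -> R)
    (D : Omega -> bool) (X : Omega -> p.-tuple R)
    (mu : p.-tuple R * bool -> R) (t : R) :
  did_model a b P Y Yobs D X -> t \in `[a, b] ->
  is_condexp P (change Yobs t) (fun w => (X w, D w)) mu ->
  fatt P Y D t
  = expect_given P [set w | D w] (fun w => mu (X w, true) - mu (X w, false))%R.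
Proof.
move=> M tab Zmu; have mD := did_group M; have mX := did_covariates M.
have [m Z0m mTF] := did_parallel_trends M tab.
have [c /andP[c0 c2] [pi0 pi0D pi0c]] := did_overlap M.
have mXD := measurable_fun_pair mX mD.
have [_ mmu imu _] := Zmu; have [_ mm im _] := Z0m.
have sec (h : p.-tuple R * bool -> R) i :
    measurable_fun setT h -> measurable_fun setT (fun x => h (x, i)).
  move=> mh; apply: (measurableT_comp mh).
  by apply: measurable_fun_pair; [exact: measurable_id|exact: measurable_cst].
(* Being untreated is an event in [(X, D)], so locality can compare [mu] and [m] there. *)
have mneg : measurable_fun setT (fun xi : p.-tuple R * bool => ~~ xi.2).
  by apply: measurable_neg; exact: measurable_snd.
have mu_m : {ae P, forall w, mu (X w, false) - m (X w, false) = 0}%R.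
  apply: (@overlap_ae_eq0 _ _ _ _ _ _ D X pi0
    (fun x => mu (x, false) - m (x, false))%R c) => //.
  - by apply: measurable_funB; exact: sec.
  - by apply: filterS pi0c => w /andP[].
  - have ZZ0 w := @change_untreated _ _ _ _ _ _ _ _ _ _ _ _ w M tab.
    apply: filterS (condexp_ae_eq_on mXD mneg Zmu Z0m ZZ0) => w /= + nDw.
    by move=> /(_ nDw); rewrite (negPf nDw) => ->; rewrite subrr.
rewrite (fatt_decomp M tab) /expect_given; congr (_ * _).
rewrite (condexp_integral_bool mD Zmu) (condexp_integral_bool mD Z0m).
have iDmu := integrable_boolM mD imu; have iDm := integrable_boolM mD im.
rewrite integral_bool; apply: etrans (esym (integralB measurableT iDmu iDm)) _.
apply: ae_eq_integral => //.
- by apply: emeasurable_funB; [exact: measurable_int iDmu|exact: measurable_int iDm].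
- apply/measurable_EFinP/measurable_funM; first exact: measurable_natr_bool.
  have msec i : measurable_fun setT (fun w => mu (X w, i)).
    exact: (measurableT_comp (sec mu i mmu) mX).
  exact: measurable_funB.
(* On the treated, [m(X, 1) = m(X, 0) = mu(X, 0)] turns [mu - m] into the regression contrast. *)
- apply: filterS2 mTF mu_m => w e1 /subr0_eq e2 _; rewrite -EFinB e2 -e1.
  by congr EFin => /=; case: (D w) => /=; ring.
Qed.

(** * Transfer between models with the same law *)

(** Both sides are the integral of [h] over [A] against the common image measure. *)
Lemma same_law_integral (R : realType) (p : nat) (d d' : measure_display)
    (Omega : measurableType d) (Omega' : measurableType d')
    (P : probability Omega R) (P' : probability Omega' R)
    (Z : Omega -> R) (D : Omega -> bool) (X : Omega -> p.-tuple R)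
    (Z' : Omega' -> R) (D' : Omega' -> bool) (X' : Omega' -> p.-tuple R)
    (h : R * bool * p.-tuple R -> R) (A : set (R * bool * p.-tuple R)) :
  measurable_fun setT Z -> measurable_fun setT D -> measurable_fun setT X ->
  measurable_fun setT Z' -> measurable_fun setT D' -> measurable_fun setT X' ->
  same_law P P' Z D X Z' D' X' ->
  measurable_fun setT h -> measurable A ->
  P.-integrable setT (fun w => (h (Z w, D w, X w))%:E) ->
  P'.-integrable setT (fun w => (h (Z' w, D' w, X' w))%:E) ->
  \int[P]_(w in [set w | A (Z w, D w, X w)]) (h (Z w, D w, X w))%:E
  = \int[P']_(w in [set w | A (Z' w, D' w, X' w)]) (h (Z' w, D' w, X' w))%:E.
Proof.
move=> mZ mD mX mZ' mD' mX' PP' mh mA ih ih'.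
have mO := measurable_fun_pair (measurable_fun_pair mZ mD) mX.
have mO' := measurable_fun_pair (measurable_fun_pair mZ' mD') mX'.
have mhE : measurable_fun setT (EFin \o h) by exact/measurable_EFinP.
have mOA := mO measurableT _ mA; rewrite setTI in mOA.
have mOA' := mO' measurableT _ mA; rewrite setTI in mOA'.
have iA := integrableS measurableT mOA (@subsetT _ _) ih.
have iA' := integrableS measurableT mOA' (@subsetT _ _) ih'.
rewrite -(integral_pushforward mO mhE iA mA).
rewrite -(integral_pushforward mO' mhE iA' mA).
by apply: eq_measure_integral => B mB _; exact: PP'.
Qed.

(** The equations defining a propensity compare integrals of functions of the triple over events of
    [X], hence depend on its law only. The bound [k] gives integrability under the second
    measure. *)
Lemma same_law_propensity (R : realType) (p : nat) (d d' : measure_display)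
    (Omega : measurableType d) (Omega' : measurableType d')
    (P : probability Omega R) (P' : probability Omega' R)
    (Z : Omega -> R) (D : Omega -> bool) (X : Omega -> p.-tuple R)
    (Z' : Omega' -> R) (D' : Omega' -> bool) (X' : Omega' -> p.-tuple R)
    (pi0 : p.-tuple R -> R) (k : R) :
  measurable_fun setT Z -> measurable_fun setT D -> measurable_fun setT X ->
  measurable_fun setT Z' -> measurable_fun setT D' -> measurable_fun setT X' ->
  same_law P P' Z D X Z' D' X' -> (forall x, `|pi0 x| <= k)%R ->
  is_condexp P (fun w => (D w)%:R) X pi0 ->
  is_condexp P' (fun w => (D' w)%:R) X' pi0.
Proof.
move=> mZ mD mX mZ' mD' mX' PP' pik [iD mpi0 ipi eqD].
have bounded_integrable (f : Omega' -> R) (j : R) : measurable_fun setT f ->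
    (forall w, `|f w| <= j)%R -> P'.-integrable setT (EFin \o f).
  move=> mf fj.
  have i1 : P'.-integrable setT (EFin \o cst 1%R).
    exact: finite_measure_integrable_cst.
  by have := integrable_weight mf fj i1; under eq_fun do rewrite mulr1.
have iD' : P'.-integrable setT (EFin \o (fun w => (D' w)%:R)).
  apply: (bounded_integrable _ 1%R); first exact: measurable_natr_bool.
  by move=> w; case: (D' w); rewrite ?normr1 ?normr0.
have ipi' : P'.-integrable setT (EFin \o (pi0 \o X')).
  apply: (bounded_integrable _ k); first exact: measurableT_comp.
  by move=> w; exact: pik.
split => // C mC.
pose A := (@snd (R * bool) (p.-tuple R)) @^-1` C.
have mA : measurable A.
  by rewrite -[X in measurable X]setTI; exact: measurable_snd.
have mh1 : measurable_fun setT (fun x : R * bool * p.-tuple R => x.1.2%:R : R)%R.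
  apply: measurable_natr_bool.
  exact: (measurableT_comp measurable_snd measurable_fst).
have mh2 : measurable_fun setT (fun x : R * bool * p.-tuple R => pi0 x.2).
  exact: (measurableT_comp mpi0 measurable_snd).
have e1 := same_law_integral mZ mD mX mZ' mD' mX' PP' mh1 mA iD iD'.
have e2 := same_law_integral mZ mD mX mZ' mD' mX' PP' mh2 mA ipi ipi'.
by apply: etrans (esym e1) (etrans (eqD C mC) e2).
Qed.

(** * Identification formulas and dependence on the law alone *)

Theorem mainTheorem1 (R : realType) (a b : R) (hab : (a <= b)%R) (p : nat)
    (d : measure_display) (Omega : measurableType d) (P : probability Omega R)
    (Y : bool -> bool -> Omega -> R -> R) (Yobs : bool -> Omega -> R -> R)
    (D : Omega -> bool) (X : Omega -> p.-tuple R)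
    (model : did_model a b P Y Yobs D X) :
  (* both identification formulas, for all versions of pi0 and of the mu_i *)
  (forall (pi0 : p.-tuple R -> R) (mu : bool -> p.-tuple R -> R -> R),
     is_condexp P (fun w => (D w)%:R) X pi0 ->
     (forall t : R, t \in `[a, b] ->
        is_condexp P (change Yobs t) (fun w => (X w, D w))
          (fun xi : p.-tuple R * bool => mu xi.2 xi.1 t)) ->
     let p0 := fine (P [set w | D w]) in
     forall t : R, t \in `[a, b] ->
       fatt P Y D t
       = expect_given P [set w | D w]
           (fun w => (mu true (X w) t - mu false (X w) t)%R)
       /\
       fatt P Y D t
       = 'E_P[fun w => ((D w)%:R / p0 * change Yobs t w)%R]
         - 'E_P[fun w => ((1 - (D w)%:R) * pi0 (X w)
                           / (p0 * (1 - pi0 (X w))) * change Yobs t w)%R])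
  /\
  (* tau0(t) is determined by the law of the observables *)
  (forall (d' : measure_display) (Omega' : measurableType d')
     (P' : probability Omega' R)
     (Y' : bool -> bool -> Omega' -> R -> R) (Yobs' : bool -> Omega' -> R -> R)
     (D' : Omega' -> bool) (X' : Omega' -> p.-tuple R),
     did_model a b P' Y' Yobs' D' X' ->
     forall t : R, t \in `[a, b] ->
       same_law P P' (change Yobs t) D X (change Yobs' t) D' X' ->
       fatt P' Y' D' t = fatt P Y D t).
Proof.
have mD := did_group model; have mX := did_covariates model.
split=> [pi0 mu pi0D Zmu p0 t tab|d' Omega' P' Y' Yobs' D' X' model' t tab PP'].
  split; first exact: (fatt_regression model tab (Zmu t tab)).
  (* The weighting formula is obtained for the truncated version and carried back to [pi0] by almost
     sure equality. *)
  have [c [pi1 [c0 pi1c pi1D pi01]]] := bounded_propensity model pi0D.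
  have [iw ->] := fatt_weighting model tab pi1D c0 pi1c.
  have iZ := did_integrable model tab; have iDZ := integrable_boolM mD iZ.
  have mZ : measurable_fun setT (change Yobs t).
    by apply/measurable_EFinP; exact: measurable_int iZ.
  have [_ mpi0 _ _] := pi0D.
  (* Distributing over a difference of extended reals needs a finite term, given by
     integrability. *)
  rewrite -/p0 muleBr//; last first.
    by rewrite fin_num_adde_defr// (integrable_fin_num measurableT iDZ).
  rewrite -(integralZl measurableT iDZ) -(integralZl measurableT iw).
  rewrite unlock; congr (_ - _).
    by apply: eq_integral => w _; rewrite -EFinM; congr EFin; ring.
  have iw0 := integrableZl measurableT p0^-1%R iw.
  apply: ae_eq_integral => //.
  - exact: measurable_int iw0.
  - have mpX : measurable_fun setT (fun w => pi0 (X w)).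
      exact: measurableT_comp.
    apply/measurable_EFinP/measurable_funM => //; apply: measurable_funM.
      apply: measurable_funM => //; apply: measurable_funB => //.
      exact: measurable_natr_bool.
    by apply: measurable_funV; apply: measurable_funM => //; exact: measurable_funB.
  - apply: filterS pi01 => w -> _; rewrite -EFinM invfM; congr EFin; ring.
have mD' := did_group model'; have mX' := did_covariates model'.
have iZ := did_integrable model tab; have iZ' := did_integrable model' tab.
have mZ : measurable_fun setT (change Yobs t).
  by apply/measurable_EFinP; exact: measurable_int iZ.
have mZ' : measurable_fun setT (change Yobs' t).
  by apply/measurable_EFinP; exact: measurable_int iZ'.
(* A single truncated propensity serves both models, so both weighting formulas integrate the same
   functions of the triple. *)
have [_ _ [pi2 pi2D _]] := did_overlap model.
have [c [pi0 [c0 pi0c pi0D _]]] := bounded_propensity model pi2D.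
have pi0_1 x : (`|pi0 x| <= 1)%R.
  by have /andP[? ?] := pi0c x; rewrite ler_norml; apply/andP; split; lra.
have pi0D' := same_law_propensity mZ mD mX mZ' mD' mX' PP' pi0_1 pi0D.
have [iw ->] := fatt_weighting model tab pi0D c0 pi0c.
have [iw' ->] := fatt_weighting model' tab pi0D' c0 pi0c.
have [_ mpi0 _ _] := pi0D.
have mz : measurable_fun setT (fun x : R * bool * p.-tuple R => x.1.1).
  exact: (measurableT_comp measurable_fst measurable_fst).
have mi : measurable_fun setT (fun x : R * bool * p.-tuple R => x.1.2).
  exact: (measurableT_comp measurable_snd measurable_fst).
have mir := @measurable_natr_bool R _ _ _ mi.
have mpi : measurable_fun setT (fun x : R * bool * p.-tuple R => pi0 x.2).
  exact: (measurableT_comp mpi0 measurable_snd).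
have mh1 : measurable_fun setT
    (fun x : R * bool * p.-tuple R => x.1.2%:R * x.1.1)%R by exact: measurable_funM.
have mh2 : measurable_fun setT (fun x : R * bool * p.-tuple R =>
    (1 - x.1.2%:R) * (pi0 x.2 / (1 - pi0 x.2)) * x.1.1)%R.
  apply: measurable_funM => //; apply: measurable_funM; first exact: measurable_funB.
  by apply: measurable_funM => //; apply: measurable_funV; exact: measurable_funB.
have PD : P [set w | D w] = P' [set w | D' w].
  have mA : measurable [set x : R * bool * p.-tuple R | x.1.2].
    have := mi measurableT [set true] I; rewrite setTI; exact.
  exact: PP' mA.
have E1 := same_law_integral mZ mD mX mZ' mD' mX' PP' mh1 measurableT
  (integrable_boolM mD iZ) (integrable_boolM mD' iZ').
have E2 := same_law_integral mZ mD mX mZ' mD' mX' PP' mh2 measurableT iw iw'.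
by rewrite PD; congr (_ * (_ - _)); apply/esym; [exact: E1|exact: E2].
Qed.
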